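(* For $k=1,\ldots,K$ let $g_k$ be a real-valued function of pairs of nonnegative integers, and consider the reward function $$R(\mathcal I,i)=1(i\in\mathcal I)-g_{k(i)}\bigl(|\mathcal I_{k(i)}|,\,|\mathcal I|-|\mathcal I_{k(i)}|\bigr),\qquad \mathcal I\subset\mathcal N,\ i\in\mathcal N .$$ Then the optimal classifier for $R$ is a composite classifier: for each $z\in\mathcal Z$ it is $\hat I(z)=\hat I_{\mathbf m(z)}$, where $$\mathbf m(z)=\operatorname*{arg\,max}_{\mathbf m=(m_1,\ldots,m_K)}\ \sum_{k=1}^K\bigl[v_k(m_k;z)-P_k\,g_k(m_k,m-m_k)\bigr],$$ the maximum being over $\mathbf m\in\prod_{k=1}^K\{0,\ldots,N_k\}$, with $P_k=P_k(z)=\sum_{i\in\mathcal N_k}p_i$, $m=\sum_{k=1}^Km_k$, $v_k(m_k;z)=\sum_{j=1}^{m_k}p_{(k,N_k+1-j)}$ for $m_k\ge 1$, and $v_k(0;z)=0$ for every $k$.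
   Context: Let $N\ge 1$ and $\mathcal N=\{1,\ldots,N\}$ be a finite set of categories. The true category $I$ is a random variable with prior $\pi_i=P(I=i)$, $i\in\mathcal N$. Conditionally on $I=i$, the observation $Z\in\mathcal Z$ has density (or probability function) $f_i$. The posterior probabilities given $Z=z$ are $p_i=p_i(z)=P(I=i\mid Z=z)=\pi_if_i(z)/\sum_{j=1}^N\pi_jf_j(z)$ (the denominator being positive). The categories are partitioned into $K$ blocks $\mathcal N_1,\ldots,\mathcal N_K$ of sizes $N_1,\ldots,N_K\ge1$, $\sum_kN_k=N$, where $\mathcal N_k=\{i:\sum_{l=1}^{k-1}N_l+1\le i\le\sum_{l=1}^kN_l\}$. For $i\in\mathcal N$, $k(i)$ is the block index with $i\in\mathcal N_{k(i)}$, and for $\mathcal I\subset\mathcal N$, $\mathcal I_k=\mathcal I\cap\mathcal N_k$. Within each block the posterior probabilities $p_i$, $i\in\mathcal N_k$, are ordered as $p_{(k1)}\le\cdots\le p_{(kN_k)}$ (also written $p_{(k,j)}$), and $(kj)$ denotes the category of block $k$ whose posterior probability is $p_{(kj)}$ (ties broken in some fixed way, so that $(k1),\ldots,(kN_k)$ enumerates $\mathcal N_k$). A classifier assigns to each $z\in\mathcal Z$ a subset $\hat I(z)\subset\mathcal N$ (the empty set and all of $\mathcal N$ are allowed). A reward function $R(\mathcal I,i)$ is a real number for each $\mathcal I\subset\mathcal N$ and $i\in\mathcal N$. The value function is $V(z;\mathcal I)=E[R(\mathcal I,I)\mid Z=z]=\sum_{i=1}^NR(\mathcal I,i)\,p_i(z)$.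 The optimal (Bayes) classifier for $R$ is $\hat I(z)=\operatorname{arg\,max}_{\mathcal I\subset\mathcal N}V(z;\mathcal I)$ for each $z$. Here $\operatorname{arg\,max}$ means a point at which the maximum is attained (not necessarily unique). For $\mathbf m=(m_1,\ldots,m_K)\in\prod_{k=1}^K\{0,\ldots,N_k\}$ the composite classifier is $\hat I_{\mathbf m}=\{(kj):1\le k\le K,\ N_k+1-m_k\le j\le N_k\}$, i.e. it contains the $m_k$ categories with largest posterior probabilities from block $k$, for each $k$. $1(\cdot)$ is the indicator function and $|\cdot|$ denotes cardinality. *)

(* Defs.v *)
From HB Require Import structures.
From mathcomp Require Import all_boot all_order all_algebra.
From mathcomp Require Import all_classical all_reals all_analysis.

Set Implicit Arguments.
Unset Strict Implicit.
Unset Printing Implicit Defensive.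

Import Order.TTheory GRing.Theory Num.Theory.

Local Open Scope ring_scope.

Definition is_argmax (R : realType) (X : Type) (F : X -> R) (x : X) : Prop :=
  forall y, F y <= F x.

(* Categories are numbered from 0: [category Nk] is 'I_N for N the sum of the
   block sizes, and blocks are numbered by 'I_K.  *)
Notation category Nk := ('I_(\sum_k Nk k)%N).

Section Blocks.
Context {K : nat} (Nk : 'I_K -> nat).

Definition block (k : 'I_K) : {set category Nk} :=
  [set i : category Nk | (\sum_(l < K | l < k) Nk l <= i)%N
                      && (i < \sum_(l < K | l <= k) Nk l)%N]%SET.

Definition block_of (i : category Nk) : 'I_K := tagnat.sig1 i.

Lemma in_block (i : category Nk) (k : 'I_K) : (i \in block k) = (block_of i == k).
Proof.
have sumE (h : 'I_K) :
    (\sum_(l < K | l <= h) Nk l = \sum_(l < K | l < h) Nk l + Nk h)%N.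
  rewrite (bigD1 h) //= addnC; congr addn.
  by apply: eq_bigl => l; rewrite ltn_neqAle andbC.
have mono (h h' : 'I_K) : (h < h')%N ->
    (\sum_(l < K | l <= h) Nk l <= \sum_(l < K | l < h') Nk l)%N.
  move=> hh'; rewrite [leqRHS](bigID (fun l : 'I_K => (l <= h)%N)) /=.
  rewrite [X in (_ <= X + _)%N](eq_bigl (fun l : 'I_K => (l <= h)%N)) ?leq_addr //.
  by move=> l; case: (leqP l h); rewrite ?andbF // => lh; rewrite (leq_ltn_trans lh).
have lo : (\sum_(l < K | l < block_of i) Nk l <= i)%N.
  by rewrite [leqRHS]tagnat.rect leq_addr.
have hi : (i < \sum_(l < K | l <= block_of i) Nk l)%N.
  by rewrite [ltnLHS]tagnat.rect sumE ltn_add2l ltn_ord.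
rewrite inE; apply/andP/eqP => [[lok hik]|<-//].
apply/val_inj; case: (ltngtP (block_of i) k) => // /mono le.
- by move: (leq_trans hi (leq_trans le lok)); rewrite ltnn.
- by move: (leq_trans hik (leq_trans le lo)); rewrite ltnn.
Qed.

End Blocks.

Section Model.
Local Open Scope classical_set_scope.
Context {R : realType} {N : nat} {dO : measure_display}
  {Omega : measurableType dO} (P : probability Omega R) (Icat : Omega -> 'I_N).

Definition prior (i : 'I_N) : R := fine (P (Icat @^-1` [set i])).

(* [f i] is the density, with respect to the reference measure [mu], of the
   observation [Zobs] conditionally on [Icat = i].  The reference measure is
   arbitrary, so that probability functions are covered by counting measure. *)
Definition observation_model {dZ : measure_display} {Z : measurableType dZ}
    (Zobs : Omega -> Z) (mu : {measure set Z -> \bar R})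
    (f : 'I_N -> Z -> R) : Prop :=
  [/\ (forall i, measurable (Icat @^-1` [set i])) /\ measurable_fun setT Zobs,
      forall i, measurable_fun setT (f i),
      forall i z, 0 <= f i z,
      forall i, (\int[mu]_z (f i z)%:E = 1)%E &
      forall i (A : set Z), measurable A ->
        P (Icat @^-1` [set i] `&` Zobs @^-1` A)
        = ((prior i)%:E * \int[mu]_(z in A) (f i z)%:E)%E ].

(* P(I = i | Z = z), by Bayes' formula. *)
Definition posterior {Z : Type} (f : 'I_N -> Z -> R) (z : Z) (i : 'I_N) : R :=
  prior i * f i z / \sum_(j < N) prior j * f j z.

End Model.

Section Classifiers.
Context {R : realType} {N : nat}.

(* E[Rw(A, I) | Z = z], where [p] is the posterior distribution of I at z. *)
Definition value (Rw : {set 'I_N} -> 'I_N -> R) (p : 'I_N -> R)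
    (A : {set 'I_N}) : R :=
  \sum_(i < N) Rw A i * p i.

Definition optimal_classifier {Z : Type} (Rw : {set 'I_N} -> 'I_N -> R)
    (p : Z -> 'I_N -> R) (Ihat : Z -> {set 'I_N}) : Prop :=
  forall z, is_argmax (value Rw (p z)) (Ihat z).

End Classifiers.

Section Composite.
Context {R : realType} {K : nat} {Nk : 'I_K -> nat}.
Implicit Types (p : category Nk -> R) (k : 'I_K).

(* [c k j] is the category (k, j+1): the ranks within a block run over
   0, ..., N_k - 1.  Any way of breaking ties is allowed. *)
Definition block_ranking p (c : forall k, 'I_(Nk k) -> category Nk) : Prop :=
  forall k, [/\ injective (c k),
                forall i, i \in block Nk k <-> exists j, c k j = i &
                forall j j' : 'I_(Nk k), (j <= j')%N -> p (c k j) <= p (c k j')].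

Definition reward (g : 'I_K -> nat -> nat -> R) (A : {set category Nk})
    (i : category Nk) : R :=
  let Ak := (A :&: block Nk (block_of i))%SET in
  (i \in A)%:R - g (block_of i) #|Ak| (#|A| - #|Ak|)%N.

Notation mvec := {dffun forall k : 'I_K, 'I_(Nk k).+1}.

Definition composite (c : forall k, 'I_(Nk k) -> category Nk) (m : mvec) :
    {set category Nk} :=
  [set i : category Nk | [exists k : 'I_K, [exists j : 'I_(Nk k),
     (Nk k + 1 - m k <= j.+1)%N && (c k j == i)]]]%SET.

Definition block_prob p k : R := \sum_(i in block Nk k) p i.

(* The sum of the [mk] largest posterior probabilities of block [k]:
   [rev_ord j] is N_k - 1 - j. *)
Definition top_sum p (c : forall k, 'I_(Nk k) -> category Nk) k (mk : nat) : R :=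
  \sum_(j < Nk k | (j < mk)%N) p (c k (rev_ord j)).

Definition composite_objective (g : 'I_K -> nat -> nat -> R) p
    (c : forall k, 'I_(Nk k) -> category Nk) (m : mvec) : R :=
  \sum_(k < K) (top_sum p c k (m k)
                - block_prob p k * g k (m k) (\sum_(l < K) m l - m k)%N).

End Composite.

(* Main.v *)
Require Import Defs.
From mathcomp Require Import all_boot all_order all_algebra.
From mathcomp Require Import all_classical all_reals all_analysis.
Import Order.TTheory GRing.Theory Num.Theory.
Local Open Scope ring_scope.

(** Write [A_k] for the part of a set [A] of categories inside block [k].  Since
    the penalty of a category depends on it only through its block, summing
    the reward against [p] gives

      value A = \sum_k (\sum_(i in A_k) p i
                        - P_k * g k #|A_k| (#|A| - #|A_k|))

    ([value_rewardE]).  The penalty terms involve [A] only through the block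
    counts [#|A_k|], because [#|A|] is their sum.  Among the sets with
    prescribed block counts, the gain [\sum_(i in A_k) p i] is largest when
    [A_k] consists of the top-ranked categories of block [k], which is an
    exchange argument on a nondecreasing sequence ([sum_le_top]).  Hence every
    [A] satisfies [value A <= objective (counts of A)]
    ([value_reward_le_objective]), while a composite classifier attains
    [value (composite m) = objective m] ([value_reward_composite]).  A maximizer
    of the objective therefore yields a maximizer of the value, and one exists
    because there are finitely many count vectors. *)

(** * Largest sums over a nondecreasing sequence *)

Definition top_set n b : {set 'I_n} := [set j : 'I_n | (n - b <= j)%N]%SET.

Lemma sum_top_setE (V : nmodType) n b (F : 'I_n -> V) :
  \sum_(j < n | (j < b)%N) F (rev_ord j) = \sum_(j in top_set n b) F j.
Proof.
rewrite [RHS](reindex_inj rev_ord_inj) /=; apply: eq_bigl => j.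
by rewrite inE /= leq_sub2lE.
Qed.

Lemma card_top_set n b : (b <= n)%N -> #|top_set n b| = b.
Proof.
move=> b_le_n; rewrite -sum1_card -(sum_top_setE _ _ _ (fun=> 1%N)).
by rewrite (big_ord_narrow b_le_n) sum1_card card_ord.
Qed.

(** Exchange argument: [B] and the top set of the same size differ by equally
    many elements on each side, and the value of [F] at the lowest rank of the
    top set separates those of [B :\: top] from those of [top :\: B]. *)
Lemma sum_le_top (R : numDomainType) n (F : 'I_n -> R) (B : {set 'I_n}) :
  (forall j j' : 'I_n, (j <= j')%N -> F j <= F j') ->
  \sum_(j in B) F j <= \sum_(j < n | (j < #|B|)%N) F (rev_ord j).
Proof.
move=> F_mono; rewrite sum_top_setE; set T := top_set _ _.
have B_le_n : (#|B| <= n)%N by rewrite -[leqRHS]card_ord max_card.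
have [/eqP|B_gt0] := posnP #|B|.
  rewrite cards_eq0 /T => /eqP ->; rewrite big_set0 cards0 big1 // => j.
  by rewrite inE subn0 leqNgt ltn_ord.
have thr_lt_n : (n - #|B| < n)%N by rewrite ltn_subrL B_gt0 (leq_trans B_gt0).
pose thr := F (Ordinal thr_lt_n).
have card_diff : #|B :\: T| = #|T :\: B|.
  by rewrite !cardsD (card_top_set _ _ B_le_n) finset.setIC.
rewrite (big_setID T) [leRHS](big_setID B) /= finset.setIC lerD2l.
apply: (@le_trans _ _ (\sum_(j in B :\: T) thr)).
  apply: ler_sum => j; rewrite !inE -ltnNge => /andP[/ltnW j_le _].
  exact: F_mono.
rewrite sumr_const card_diff -sumr_const; apply: ler_sum => j.
by rewrite !inE => /andP[_ ?]; apply: F_mono.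
Qed.

(** * Decomposition along blocks *)

Section BlockSums.
Context {K : nat} {Nk : 'I_K -> nat}.
Implicit Types (A : {set category Nk}) (k : 'I_K).

Lemma sum_blocks (V : nmodType) A (F : category Nk -> V) :
  \sum_(i in A) F i = \sum_k \sum_(i in A :&: block Nk k) F i.
Proof.
rewrite (partition_big (@block_of K Nk) predT) //=; apply: eq_bigr => k _.
by apply: eq_bigl => i; rewrite inE in_block.
Qed.

Lemma card_blocks A : #|A| = (\sum_k #|A :&: block Nk k|)%N.
Proof.
rewrite -sum1_card [LHS](sum_blocks _ A (fun=> 1%N)).
by apply: eq_bigr => k _; rewrite sum1_card.
Qed.

Context {R : realType} (g : 'I_K -> nat -> nat -> R) (p : category Nk -> R).

Lemma value_rewardE A :
  value (reward g) p A =
  \sum_k (\sum_(i in A :&: block Nk k) p i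
          - block_prob p k
            * g k #|A :&: block Nk k| (#|A| - #|A :&: block Nk k|)%N).
Proof.
rewrite sumrB -sum_blocks /value /reward.
transitivity (\sum_i ((i \in A)%:R * p i
    - g (block_of i) #|A :&: block Nk (block_of i)|
        (#|A| - #|A :&: block Nk (block_of i)|)%N * p i)).
  by apply: eq_bigr => i _; rewrite mulrBl.
rewrite sumrB; congr (_ - _).
  rewrite [RHS]big_mkcond; apply: eq_bigr => i _.
  by case: (i \in A); rewrite ?mul1r ?mul0r.
rewrite (partition_big (@block_of K Nk) predT) //=; apply: eq_bigr => k _.
rewrite /block_prob mulr_suml; apply: eq_big => [i|i /eqP ->].
  by rewrite in_block.
by rewrite mulrC.
Qed.

End BlockSums.

(** * Composite classifiers are extremal *)

Section Ranked.
Context {R : realType} {K : nat} {Nk : 'I_K -> nat}.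
Context (g : 'I_K -> nat -> nat -> R) (p : category Nk -> R).
Context (c : forall k : 'I_K, 'I_(Nk k) -> category Nk).
Hypothesis c_ranking : block_ranking p c.
Implicit Types (A : {set category Nk}) (k : 'I_K).
Notation mvec := {dffun forall k : 'I_K, 'I_(Nk k).+1}.

Lemma rank_inj k : injective (c k).
Proof. by case: (c_ranking k). Qed.

Lemma block_of_rank k j : block_of (c k j) = k.
Proof.
apply/eqP; rewrite -in_block; case: (c_ranking k) => _ c_block _.
by apply/c_block; exists j.
Qed.

(** The ranking transports subsets of a block to subsets of ['I_(Nk k)], where
    the order of the posterior probabilities is the order of the ordinals. *)
Lemma setI_block_rank A k :
  A :&: block Nk k = c k @: [set j | c k j \in A]%SET.
Proof.
apply/setP => i; rewrite inE; apply/andP/imsetP => [[iA]|[j]].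
  case: (c_ranking k) => _ c_block _ /c_block[j def_i].
  by exists j; rewrite ?inE ?def_i.
by rewrite inE => jA ->; rewrite in_block block_of_rank.
Qed.

Lemma card_setI_block A k :
  #|A :&: block Nk k| = #|[set j | c k j \in A]%SET|.
Proof. by rewrite setI_block_rank card_imset //; apply: rank_inj. Qed.

Lemma sum_setI_block (V : nmodType) A k (F : category Nk -> V) :
  \sum_(i in A :&: block Nk k) F i
    = \sum_(j in [set j | c k j \in A]%SET) F (c k j).
Proof.
by rewrite setI_block_rank big_imset //= => j j' _ _; apply: rank_inj.
Qed.

Lemma card_setI_block_lt A k : (#|A :&: block Nk k| < (Nk k).+1)%N.
Proof. by rewrite card_setI_block ltnS -[leqRHS]card_ord max_card. Qed.

Definition block_counts A : mvec :=
  [ffun k => Ordinal (card_setI_block_lt A k)].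

Lemma sum_setI_block_le A k :
  \sum_(i in A :&: block Nk k) p i <= top_sum p c k #|A :&: block Nk k|.
Proof.
rewrite sum_setI_block card_setI_block /top_sum.
by apply: (sum_le_top _ _ (fun j => p (c k j))); case: (c_ranking k).
Qed.

Lemma value_reward_le_objective A :
  value (reward g) p A <= composite_objective g p c (block_counts A).
Proof.
rewrite value_rewardE /composite_objective; apply: ler_sum => k _.
have -> : (\sum_l block_counts A l)%N = #|A|.
  by rewrite card_blocks; apply: eq_bigr => l _; rewrite ffunE.
by rewrite ffunE /= lerD2r sum_setI_block_le.
Qed.

Lemma composite_rank (m : mvec) k :
  [set j | c k j \in composite c m]%SET = top_set (Nk k) (m k).
Proof.
have rankE (h : 'I_K) (j : 'I_(Nk h)) :
    (Nk h + 1 - m h <= j.+1)%N = (Nk h - m h <= j)%N.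
  by rewrite addn1 subSn // -ltnS ltn_ord.
apply/setP => j; rewrite !inE.
apply/existsP/idP => [[k' /existsP[j' /andP[j'_top /eqP eq_c]]]|j_top].
  (* [k'] must be replaced by [k] before [rank_inj], as the type of [j']
     depends on it. *)
  have eq_k : k' = k by rewrite -(block_of_rank k j) -eq_c block_of_rank.
  subst k'; rewrite rankE in j'_top.
  by rewrite -(rank_inj k _ _ eq_c).
by exists k; apply/existsP; exists j; rewrite rankE j_top eqxx.
Qed.

Lemma card_composite_block (m : mvec) k :
  #|composite c m :&: block Nk k| = m k.
Proof.
by rewrite card_setI_block composite_rank card_top_set // -ltnS ltn_ord.
Qed.

Lemma value_reward_composite (m : mvec) :
  value (reward g) p (composite c m) = composite_objective g p c m.
Proof.
rewrite value_rewardE /composite_objective; apply: eq_bigr => k _.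
rewrite sum_setI_block composite_rank -(sum_top_setE _ _ _ (fun j => p (c k j))).
rewrite card_composite_block card_blocks.
by under [X in (X - _)%N]eq_bigr do rewrite card_composite_block.
Qed.

End Ranked.

Theorem proposition2 (R : realType) (K : nat) (Nk : 'I_K -> nat)
    (N_ge1 : (1 <= \sum_(k < K) Nk k)%N)
    (Nk_ge1 : forall k, (1 <= Nk k)%N)
    (dO : measure_display) (Omega : measurableType dO)
    (P : probability Omega R) (Icat : Omega -> category Nk)
    (dZ : measure_display) (Z : measurableType dZ) (Zobs : Omega -> Z)
    (mu : {measure set Z -> \bar R}) (f : category Nk -> Z -> R)
    (model : observation_model P Icat Zobs mu f)
    (den_gt0 : forall z, 0 < \sum_i prior P Icat i * f i z)
    (c : Z -> forall k : 'I_K, 'I_(Nk k) -> category Nk)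
    (c_ranking : forall z, block_ranking (posterior P Icat f z) (c z))
    (g : 'I_K -> nat -> nat -> R) :
  let p := posterior P Icat f in
  let maximizes (mhat : Z -> {dffun forall k : 'I_K, 'I_(Nk k).+1}) :=
    forall z, is_argmax (composite_objective g (p z) (c z)) (mhat z) in
  (exists mhat, maximizes mhat) /\
  (forall mhat, maximizes mhat ->
     optimal_classifier (reward g) p (fun z => composite (c z) (mhat z))).
Proof.
move=> p maximizes; split=> [|mhat mhat_max z A].
  pose obj z := composite_objective g (p z) (c z).
  pose m0 : {dffun forall k : 'I_K, 'I_(Nk k).+1} := [ffun k => ord0].
  exists (fun z => [arg max_(m > m0) obj z m]%O) => z m.
  by case: arg_maxP => // m' _; apply.
rewrite (value_reward_composite _ _ _ (c_ranking z)).
exact: le_trans (value_reward_le_objective _ _ _ (c_ranking z) A) (mhat_max z _).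
Qed.
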